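(* Let $H_1$ and $H_2$ be graphs. The class of $\{H_1, H_2\}$-free graphs is bounded-apex-bipartite if and only if, up to switching the labels of $H_1$ and $H_2$, one of the following holds: 1. $H_1$ is an induced subgraph of $K_2$; 2. $H_1 \cong K_3$ and $H_2$ is an induced subgraph of $P_3 + rK_1$ for some $r\in\mathbb{N}$, or of $P_4$; or 3. $H_1$ is a complete graph and $H_2$ is edgeless.
   Context: All graphs are finite and simple. $K_r$, $P_r$ denote the complete graph and path on $r$ vertices; $G+H$ denotes the disjoint union of $G$ and $H$, and $rH$ the disjoint union of $r$ copies of $H$. ''Induced subgraph of $X$'' means isomorphic to $X[S]$ for some $S\subseteq V(X)$. For a set $\mathcal{H}$ of graphs, a graph is $\mathcal{H}$-free if none of its induced subgraphs is isomorphic to a graph in $\mathcal{H}$. A class of graphs is bounded-apex-bipartite if there is a constant $c\in\mathbb{N}$ such that every graph $G$ in the class has a set $S\subseteq V(G)$ with $|S|\le c$ such that $G-S$ is bipartite. *)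

(* Defs.v *)
From mathcomp Require Import all_boot.
Set Implicit Arguments.
Unset Strict Implicit.
Unset Printing Implicit Defensive.

(* The vertex type may be empty, so the null graph is a graph. *)
Record sgraph := SGraph {
  vertex :> finType;
  edge : rel vertex;
  edge_sym : symmetric edge;
  edge_irrefl : irreflexive edge }.

Definition graph_iso (G H : sgraph) : Prop :=
  exists2 f : G -> H, bijective f & forall x y, edge (f x) (f y) = edge x y.

Section Induced.
Variables (G : sgraph) (S : {set G}).
Definition induced_edge : rel {x : G | x \in S} :=
  fun u v => edge (val u) (val v).
Lemma induced_sym : symmetric induced_edge.
Proof. by move=> u v; apply: edge_sym. Qed.
Lemma induced_irrefl : irreflexive induced_edge.
Proof. by move=> u; apply: edge_irrefl. Qed.
Definition induced : sgraph := SGraph induced_sym induced_irrefl.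
End Induced.

Definition induced_subgraph (H X : sgraph) : Prop :=
  exists S : {set X}, graph_iso H (induced S).

Section DisjointUnion.
Variables G H : sgraph.
Definition union_edge : rel (G + H)%type := fun u v =>
  match u, v with
  | inl x, inl y => edge x y
  | inr x, inr y => edge x y
  | _, _ => false
  end.
Lemma union_sym : symmetric union_edge.
Proof. by move=> [x|x] [y|y] //=; apply: edge_sym. Qed.
Lemma union_irrefl : irreflexive union_edge.
Proof. by move=> [x|x] /=; apply: edge_irrefl. Qed.
Definition disjoint_union : sgraph := SGraph union_sym union_irrefl.
End DisjointUnion.

Section Copies.
Variables (r : nat) (H : sgraph).
Definition copies_edge : rel ('I_r * H)%type :=
  fun u v => (u.1 == v.1) && edge u.2 v.2.
Lemma copies_sym : symmetric copies_edge.
Proof. by move=> u v; rewrite /copies_edge /= eq_sym edge_sym. Qed.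
Lemma copies_irrefl : irreflexive copies_edge.
Proof. by move=> u; rewrite /copies_edge /= edge_irrefl andbF. Qed.
Definition copies : sgraph := SGraph copies_sym copies_irrefl.
End Copies.

Section StandardGraphs.
Variable r : nat.
Definition complete_edge : rel 'I_r := fun i j => i != j.
Lemma complete_sym : symmetric complete_edge.
Proof. by move=> i j; rewrite /complete_edge /= eq_sym. Qed.
Lemma complete_irrefl : irreflexive complete_edge.
Proof. by move=> i; rewrite /complete_edge /= eqxx. Qed.
Definition complete_graph : sgraph := SGraph complete_sym complete_irrefl.

Definition path_edge : rel 'I_r := fun i j : 'I_r => (i.+1 == j) || (j.+1 == i).
Lemma path_sym : symmetric path_edge.
Proof. by move=> i j; rewrite /path_edge /= orbC. Qed.
Lemma path_irrefl : irreflexive path_edge.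
Proof. by move=> i; rewrite /path_edge /= orbb; apply/eqP/nesym/n_Sn. Qed.
Definition path_graph : sgraph := SGraph path_sym path_irrefl.
End StandardGraphs.

Definition is_complete (G : sgraph) : Prop :=
  forall x y : G, x != y -> edge x y.

Definition edgeless (G : sgraph) : Prop := forall x y : G, ~~ edge x y.

Definition independent (G : sgraph) (A : {set G}) : Prop :=
  {in A &, forall x y, ~~ edge x y}.

Definition bipartite (G : sgraph) : Prop :=
  exists A : {set G}, independent A /\ independent (~: A).

Definition pair_set (H1 H2 : sgraph) : sgraph -> Prop :=
  fun H => H = H1 \/ H = H2.

Definition free (HH : sgraph -> Prop) (G : sgraph) : Prop :=
  forall (S : {set G}) (H : sgraph), HH H -> ~ graph_iso (induced S) H.

Definition bounded_apex_bipartite (C : sgraph -> Prop) : Prop :=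
  exists c : nat, forall G : sgraph, C G ->
    exists S : {set G}, #|S| <= c /\ bipartite (induced (~: S)).

(* Main.v *)
Require Import Defs.
From mathcomp Require Import all_boot.

(** Sufficiency. A [K_2]-free graph has no edge, and a graph without [K_m] and
    without [m'] independent vertices has bounded order by Ramsey's theorem.
    A triangle-free [P_4]-free graph is bipartite, each component being complete
    bipartite ([bipartite_path4_free]). In a triangle-free graph [G] without
    induced [P_3 + r K_1], Ramsey's theorem shows that every induced [P_3]
    dominates all but boundedly many vertices; since neighbourhoods are
    independent, [G] is three independent sets up to a bounded remainder, and
    [few_non_neighbors_deletion] improves three to two by looking at a pentagon
    when there is one.

    Necessity. If the [n]-th graph of a family contains [n] disjoint copies of a
    fixed non-bipartite graph, then the family needs arbitrarily large deletion
    sets, so one of its members has an induced [H1] or [H2]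
    ([bounded_apex_embeds]). Complete graphs form such a family, so one of the
    two, say [H1], is complete; let it have at least three vertices. Disjoint
    unions of heptagons and blow-ups of a pentagon are triangle-free, hence
    [H1]-free, so [H2] is induced in both. The heptagons make [H2] a linear
    forest or a graph with long cycles, and the pentagon excludes [2 K_2] and
    [P_4 + K_1] from it; what remains is [P_4] and the induced subgraphs of
    [P_3 + r K_1] ([heptagon_pentagon_paths]). If [H1] has at least four
    vertices, disjoint unions of triangles and complete tripartite graphs are
    also [H1]-free, which makes both adjacency and non-adjacency in [H2]
    transitive: [H2] is edgeless or, being triangle-free, at most [K_2]
    ([cluster_multipartite_edgeless]). *)

Set Implicit Arguments.
Unset Strict Implicit.
Unset Printing Implicit Defensive.

(** * Embeddings and bipartite deletions *)

(** A decidable form of [induced_subgraph]: the injection itself, rather than a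
    vertex set and an isomorphism onto the graph it induces. *)
Definition embeds (H X : sgraph) : bool :=
  [exists f : {ffun H -> X}, injectiveb f &&
    [forall x, [forall y, edge (f x) (f y) == edge x y]]].

Lemma embedsP (H X : sgraph) :
  reflect (exists2 f : H -> X, injective f
             & forall x y, edge (f x) (f y) = edge x y) (embeds H X).
Proof.
apply: (iffP existsP) => [[f /andP[/injectiveP injf /forallP ef]]|[f injf ef]].
  by exists f => // x y; apply/eqP; move/forallP: (ef x); apply.
exists [ffun x => f x]; apply/andP; split.
  by apply/injectiveP => x y; rewrite !ffunE => /injf.
by apply/forallP => x; apply/forallP => y; rewrite !ffunE ef.
Qed.

Lemma induced_subgraphP (H X : sgraph) : induced_subgraph H X <-> embeds H X.
Proof.
split=> [[S [f bijf ef]]|/embedsP[f injf ef]].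
  apply/embedsP; exists (fun x => val (f x)); last by move=> x y; rewrite -ef.
  by move=> x y /val_inj/(bij_inj bijf).
have Sf x : f x \in [set f z | z : H] by apply: imset_f.
pose g x : induced [set f z | z : H] := Sub (f x) (Sf x).
exists [set f z | z : H], g; last by move=> x y; rewrite -ef.
have injg : injective g by move=> x y /(congr1 val)/injf.
by apply: inj_card_bij injg _; rewrite card_sig (card_imset _ injf).
Qed.

Lemma embeds_trans (X H G : sgraph) : embeds H X -> embeds X G -> embeds H G.
Proof.
move=> /embedsP[f injf ef] /embedsP[g injg eg]; apply/embedsP.
exists (g \o f); first exact: inj_comp.
by move=> x y; rewrite /= eg ef.
Qed.

Lemma graph_iso_sym (G H : sgraph) : graph_iso G H -> graph_iso H G.
Proof.
case=> f [g fK gK] ef; exists g; first by exists f.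
by move=> x y; rewrite -ef !gK.
Qed.

Lemma freeP (H1 H2 G : sgraph) :
  free (pair_set H1 H2) G <-> ~~ embeds H1 G /\ ~~ embeds H2 G.
Proof.
split=> [frG|[nH1 nH2] S H HH /graph_iso_sym HS].
  by split; apply/negP => /induced_subgraphP[S /graph_iso_sym];
    apply: frG; [left|right].
have : embeds H G by apply/induced_subgraphP; exists S.
by case: HH => ->; apply/negP.
Qed.

(** The two colour classes of [G - S], seen as vertex sets of [G] itself: this
    avoids any further handling of induced subgraphs. *)
Lemma bipartite_deletionP (G : sgraph) (c : nat) :
  (exists S : {set G}, #|S| <= c /\ bipartite (induced (~: S))) <->
  (exists A B : {set G},
     [/\ independent A, independent B & #|~: (A :|: B)| <= c]).
Proof.
split=> [[S [leSc [A [indA indB]]]]|[A [B [indA indB leABc]]]].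
  exists (val @: A), (val @: (~: A)); split.
  - by move=> _ _ /imsetP[x Ax ->] /imsetP[y Ay ->]; apply: indA.
  - by move=> _ _ /imsetP[x Ax ->] /imsetP[y Ay ->]; apply: indB.
  apply: leq_trans leSc; apply/subset_leq_card/subsetP => x.
  rewrite !inE; apply: contraR => nSx.
  have Sx : x \in ~: S by rewrite inE.
  have [Ax|nAx] := boolP ((Sub x Sx : induced (~: S)) \in A).
    by apply/orP; left; apply/imsetP; exists (Sub x Sx).
  by apply/orP; right; apply/imsetP; exists (Sub x Sx); rewrite ?inE.
exists (~: (A :|: B)); split=> //; exists [set u | val u \in A].
split=> u v; rewrite !inE => Au Av; first exact: indA.
have inB (w : induced (~: ~: (A :|: B))) : val w \notin A -> val w \in B.
  by have := valP w; rewrite in_setC in_setC negbK inE => /orP[->|].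
by apply: indB; apply: inB.
Qed.

Lemma bipartiteP (G : sgraph) (c : nat) : bipartite G ->
  exists A B : {set G},
    [/\ independent A, independent B & #|~: (A :|: B)| <= c].
Proof.
case=> A [indA indB]; exists A, (~: A).
by split; rewrite // setUCr setCT cards0.
Qed.

(** * Cliques and independent sets *)

Definition clique (G : sgraph) (K : {set G}) : Prop :=
  {in K &, forall x y, x != y -> edge x y}.

Lemma leq_card_injection (T U : finType) (K : {set U}) : #|T| <= #|K| ->
  exists2 f : T -> U, injective f & forall x, f x \in K.
Proof.
move=> leTK; exists (fun x => enum_val (widen_ord leTK (enum_rank x))).
  by move=> x y /enum_val_inj/(congr1 val)/= /val_inj; apply: enum_rank_inj.
by move=> x; apply: enum_valP.
Qed.

Lemma embeds_clique (H G : sgraph) (K : {set G}) :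
  is_complete H -> clique K -> #|H| <= #|K| -> embeds H G.
Proof.
move=> complH cliqueK /leq_card_injection[f injf Kf].
apply/embedsP; exists f => // x y; have [->|neq_xy] := eqVneq x y.
  by rewrite !edge_irrefl.
by rewrite complH // cliqueK // (inj_eq injf).
Qed.

Lemma embeds_independent (H G : sgraph) (I : {set G}) :
  edgeless H -> independent I -> #|H| <= #|I| -> embeds H G.
Proof.
move=> edgelessH indI /leq_card_injection[f injf If].
apply/embedsP; exists f => // x y.
by rewrite (negbTE (edgelessH x y)); apply/negbTE/indI.
Qed.

(** Ramsey's theorem for two colours, inside a prescribed vertex set: split
    the other vertices of the set into neighbours and non-neighbours of one
    vertex. *)
Lemma ramsey (s t : nat) : exists N, forall (G : sgraph) (A : {set G}),
  N <= #|A| ->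
  (exists K : {set G}, [/\ K \subset A, clique K & s <= #|K|]) \/
  (exists I : {set G}, [/\ I \subset A, independent I & t <= #|I|]).
Proof.
elim: s t => [|s IHs] t.
  exists 0 => G A _; left; exists set0; split=> //; first exact: sub0set.
  by move=> x y; rewrite inE.
elim: t => [|t [N2 IHt]].
  exists 0 => G A _; right; exists set0; split=> //; first exact: sub0set.
  by move=> x y; rewrite inE.
have [N1 {}IHs] := IHs t.+1; exists (N1 + N2).+1 => G A ltA.
have /card_gt0P[v Av] := leq_ltn_trans (leq0n _) ltA.
pose Nv := [set x | edge v x].
have [le1|lt1] := leqP N1 #|(A :\ v) :&: Nv|.
- case: (IHs _ _ le1) => [] [K [sKA indK leK]]; last first.
    right; exists K; split=> //; apply: subset_trans sKA _.
    by rewrite subIset // subD1set.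
  left; exists (v |: K); split.
  + rewrite subUset sub1set Av /=; apply: subset_trans sKA _.
    by rewrite subIset // subD1set.
  + have vK x : x \in K -> edge v x.
      by move/(subsetP sKA); rewrite !inE => /andP[].
    move=> x y; rewrite !inE => /predU1P[->|Kx] /predU1P[->|Ky].
    * by rewrite eqxx.
    * by rewrite vK.
    * by rewrite edge_sym vK.
    * exact: indK.
  rewrite cardsU1 (_ : v \notin K) ?add1n //.
  by apply/negP => /(subsetP sKA); rewrite !inE eqxx.
- have le2 : N2 <= #|(A :\ v) :\: Nv|.
    rewrite -(leq_add2l N1) -ltnS; apply: leq_trans ltA _.
    rewrite (cardsD1 v A) Av -(cardsID Nv (A :\ v)) add1n ltnS leq_add2r.
    exact: ltnW.
  case: (IHt _ _ le2) => [] [K [sKA indK leK]].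
    left; exists K; split=> //; apply: subset_trans sKA _.
    by rewrite subDset subsetU // subD1set orbT.
  right; exists (v |: K); split.
  + rewrite subUset sub1set Av /=; apply: subset_trans sKA _.
    by rewrite subDset subsetU // subD1set orbT.
  + have vK x : x \in K -> ~~ edge v x.
      by move/(subsetP sKA); rewrite !inE => /andP[].
    move=> x y; rewrite !inE => /predU1P[->|Kx] /predU1P[->|Ky].
    * by rewrite edge_irrefl.
    * by rewrite vK.
    * by rewrite edge_sym vK.
    * exact: indK.
  rewrite cardsU1 (_ : v \notin K) ?add1n //.
  by apply/negP => /(subsetP sKA); rewrite !inE eqxx andbF.
Qed.

(** * Triangle-free graphs *)

Definition triangle_free (G : sgraph) : Prop :=
  forall x y z : G, edge x y -> edge y z -> ~~ edge x z.

Definition neighbors (G : sgraph) (v : G) : {set G} := [set x | edge v x].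

Definition non_neighbors3 (G : sgraph) (a v b : G) : {set G} :=
  [set x | [&& ~~ edge a x, ~~ edge v x & ~~ edge b x]].

Lemma independent_neighbors (G : sgraph) (v : G) :
  triangle_free G -> independent (neighbors v).
Proof.
by move=> trG x y; rewrite !inE edge_sym => vx vy; apply: trG vx vy.
Qed.

Lemma free_complete3 (H G : sgraph) :
  is_complete H -> #|H| <= 3 -> ~~ embeds H G -> triangle_free G.
Proof.
move=> complH leH3 nHG x y z xy yz; apply: contra nHG => xz.
have neq u v : edge u v -> u != v :> G.
  by apply: contraTneq => ->; rewrite edge_irrefl.
apply: (embeds_clique (K := [set x; y; z]) complH).
  move=> u v; rewrite !inE => /orP[/orP[]|] /eqP-> /orP[/orP[]|] /eqP->;
    by rewrite ?eqxx // edge_sym.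
apply: leq_trans leH3 _; rewrite -setUA !cardsU1 cards1 !inE negb_or.
by rewrite !neq.
Qed.

Lemma iso_complete3_free (H G : sgraph) :
  graph_iso H (complete_graph 3) -> ~~ embeds H G -> triangle_free G.
Proof.
case=> f bijf ef; apply: free_complete3.
  2: by rewrite (bij_eq_card bijf) card_ord.
by move=> x y neq_xy; rewrite -ef /= /complete_edge (inj_eq (bij_inj bijf)).
Qed.

(** * Embedding paths into a triangle-free graph *)

Lemma path4_embeds (G : sgraph) (a b c d : G) : triangle_free G ->
  edge a b -> edge b c -> edge c d -> a != c -> b != d -> ~~ edge a d ->
  embeds (path_graph 4) G.
Proof.
move=> trG ab bc cd ac bd nad.
have neq u v : edge u v -> (u == v :> G) = false.
  by apply: contraTF => /eqP->; rewrite edge_irrefl.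
have ad : a != d by apply: contraTneq ab => ->; rewrite edge_sym; apply: trG cd.
have f_uniq : uniq [:: a; b; c; d].
  by rewrite /= !inE !negb_or ac bd ad !neq.
apply/embedsP; exists (fun i : 'I_4 => nth a [:: a; b; c; d] i).
  by move=> i j /eqP; rewrite nth_uniq // => /eqP/val_inj.
have [nac nbd] := (trG _ _ _ ab bc, trG _ _ _ bc cd).
case=> [[|[|[|[|i]]]] hi] // [[|[|[|[|j]]]] hj] //; rewrite /= /path_edge /=;
  by [rewrite edge_irrefl | rewrite // edge_sym | apply/negbTE
     | rewrite edge_sym; apply/negbTE].
Qed.

Lemma path3_isolated_embeds (r : nat) (G : sgraph) (a v b : G) (I : {set G}) :
  triangle_free G -> edge v a -> edge v b -> a != b ->
  I \subset non_neighbors3 a v b -> independent I -> r <= #|I| ->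
  embeds (disjoint_union (path_graph 3) (copies r (complete_graph 1))) G.
Proof.
move=> trG va vb ab /subsetP sIW indI leI.
have neq u w : edge u w -> (u == w :> G) = false.
  by apply: contraTF => /eqP->; rewrite edge_irrefl.
have nab : ~~ edge a b by apply: trG vb; rewrite edge_sym.
have f_uniq : uniq [:: a; v; b].
  by rewrite /= !inE !negb_or ab [a == v]eq_sym !neq.
have [g injg Ig] : exists2 g : 'I_r -> G, injective g & forall i, g i \in I.
  by apply: leq_card_injection; rewrite card_ord.
pose p (i : 'I_3) := nth a [:: a; v; b] i.
have pg i j : edge (p i) (g j) = false.
  have := sIW _ (Ig j); rewrite inE => /and3P[aj vj bj]; apply/negbTE.
  by case: i => [[|[|[|i]]]].
have pgN i j : p i <> g j.
  move=> eq_pg; have := sIW _ (Ig j); rewrite -eq_pg inE.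
  case: i {eq_pg} => [[|[|[|i]]]] hi //=; rewrite ?va ?vb ?andbF //.
  by rewrite edge_sym va.
have complete1 (k l : 'I_1) : complete_edge k l = false.
  by rewrite /complete_edge (ord1 k) (ord1 l) eqxx.
apply/embedsP; exists (fun u => match u with inl i => p i | inr j => g j.1 end).
  case=> [i|[i k]] [j|[j l]] //=; rewrite ?[k]ord1 ?[l]ord1.
  - by move/eqP; rewrite nth_uniq // => /eqP/val_inj ->.
  - by move/pgN.
  - by move/esym/pgN.
  - by move/injg->.
case=> [i|[i k]] [j|[j l]] /=; last 3 first.
- exact: pg.
- by rewrite edge_sym pg.
- rewrite /copies_edge /= complete1 andbF; exact/negbTE/indI.
case: i j => [[|[|[|i]]] hi] // [[|[|[|j]]] hj] //; rewrite /p /= /path_edge /=;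
  by [rewrite edge_irrefl | rewrite // edge_sym | apply/negbTE
     | rewrite edge_sym; apply/negbTE].
Qed.

(** * Deletion sets for the listed pairs *)

(** Each component of a triangle-free graph without induced path on four
    vertices is complete bipartite: walking away from a root [r], a vertex is
    either [r], a neighbour of [r] or at distance two from it, since a vertex
    at distance three would give such a path. Colour a vertex according to
    whether it is adjacent to the root of its component. *)
Lemma bipartite_path4_free (G : sgraph) : triangle_free G ->
  (forall a b c d : G, edge a b -> edge b c -> edge c d -> a != c -> b != d ->
     edge a d) ->
  bipartite G.
Proof.
move=> trG P4G; have csym := sym_connect_sym (@edge_sym G).
have near_root r x : connect (@edge G) r x ->
    [|| x == r, edge r x | [exists z, edge r z && edge z x]].
  pose near := [pred x | [|| x == r, edge r x
                           | [exists z, edge r z && edge z x]]].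
  move=> /(closed_connect (a := near)); rewrite !inE eqxx => <- //.
  apply: (intro_closed csym) => {}x y xy.
  rewrite !inE => /or3P[/eqP<-|rx|/existsP[z /andP[rz zx]]].
  - by rewrite xy orbT.
  - by apply/or3P/Or33/existsP; exists x; rewrite rx.
  - have [->|neq_xr] := eqVneq r x; first by rewrite xy orbT.
    have [eq_zy|neq_zy] := eqVneq z y; first by rewrite -eq_zy rz orbT.
    by rewrite (P4G r z x y) ?orbT.
exists [set x | edge x (root (@edge G) x)]; split=> x y; rewrite !inE => xr yr.
  apply: contraL yr => xy.
  rewrite -(rootP csym (connect1 xy)); apply: trG xr.
  by rewrite edge_sym.
apply/negP => xy; move: xr yr.
rewrite -(rootP csym (connect1 xy)) ![edge _ (root _ _)]edge_sym.
set r := root _ x => rx ry.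
have cxr : connect (@edge G) r x by rewrite csym connect_root.
case/or3P: (near_root _ _ cxr) => [/eqP xr|rx'|/existsP[z /andP[rz zx]]].
- by rewrite -xr xy in ry.
- by rewrite rx' in rx.
have neq_rx : r != x by apply: contraNneq ry => ->.
have neq_zy : z != y by apply: contraNneq ry => <-.
by rewrite (P4G r z x y) in ry.
Qed.

(** Two adjacent vertices of a pentagon dominate nearly everything: a vertex
    adjacent to neither is missed by one of the two paths [v4 v0 v1] and
    [v0 v1 v2], or it is adjacent to both [v4] and [v2]. *)
Lemma pentagon_domination (G : sgraph) (R : nat) (v0 v1 v2 v4 : G) :
  triangle_free G ->
  #|non_neighbors3 v4 v0 v1| <= R -> #|non_neighbors3 v0 v1 v2| <= R ->
  #|neighbors v2 :&: neighbors v4| <= R ->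
  exists A B : {set G},
    [/\ independent A, independent B & #|~: (A :|: B)| <= 3 * R].
Proof.
move=> trG le401 le012 le24; exists (neighbors v0), (neighbors v1).
split; try exact: independent_neighbors.
apply: leq_trans (_ : #|non_neighbors3 v4 v0 v1 :|: non_neighbors3 v0 v1 v2
                        :|: (neighbors v2 :&: neighbors v4)| <= _).
  apply/subset_leq_card/subsetP => x; rewrite !inE.
  by case: (edge v0 x) (edge v1 x) (edge v2 x) (edge v4 x) => [] [] [] [].
rewrite !mulSn mul0n addn0 addnA.
apply: leq_trans (leq_card_setU _ _) (leq_add _ le24).
exact: leq_trans (leq_card_setU _ _) (leq_add le401 le012).
Qed.

(** Every induced path [a v b] dominates all but at most [R] vertices, by the
    three independent sets [N(a)], [N(v)] and [N(b)]; the point is to do with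
    two. If no edge joins [N(a)] to [N(b)], then [N(v)] and [N(a) :|: N(b)]
    are independent. Otherwise such an edge [c d] closes the path to a pentagon
    [a v b d c]. If [N(b) :&: N(c)] is small, [a] and [v] dominate nearly
    everything. If not, it has two vertices [x] and [y]; the path [x c y] is
    adjacent to no vertex of [N(a) :&: N(b)], so this set is small and [d] and
    [c] dominate nearly everything. *)
Lemma few_non_neighbors_deletion (G : sgraph) (R : nat) : triangle_free G ->
  0 < R ->
  (forall a v b : G, edge v a -> edge v b -> a != b ->
     #|non_neighbors3 a v b| <= R) ->
  exists A B : {set G},
    [/\ independent A, independent B & #|~: (A :|: B)| <= 3 * R].
Proof.
move=> trG R_gt0 leW.
pose P3 (p : G * G * G) := [&& edge p.1.2 p.1.1, edge p.1.2 p.2 & p.1.1 != p.2].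
case: (pickP P3) => [[[a v] b] /and3P[/= va vb ab]|noP3]; last first.
  apply: bipartiteP; apply: bipartite_path4_free => // a b c d ab bc _ ac _.
  by have := noP3 (a, b, c); rewrite /P3 /= edge_sym ab bc ac.
pose cross (p : G * G) := [&& edge a p.1, edge b p.2 & edge p.1 p.2].
case: (pickP cross) => [[c d] /and3P[/= ac bd cd]|no_cross]; last first.
  exists (neighbors v), (neighbors a :|: neighbors b); split.
  - exact: independent_neighbors.
  - move=> x y; rewrite !inE => /orP[ax|bx] /orP[ay|by_].
    + by apply: trG ay; rewrite edge_sym.
    + by have := no_cross (x, y); rewrite /cross /= ax by_ /= => ->.
    + by have := no_cross (y, x); rewrite /cross /= ay bx edge_sym /= => ->.
    + by apply: trG by_; rewrite edge_sym.
  apply: leq_trans (leq_trans (leW a v b va vb ab) (leq_pmull R _)) => //.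
  apply/subset_leq_card/subsetP => x; rewrite !inE.
  by case: (edge a x) (edge v x) (edge b x) => [] [] [].
have [nab nvd] : ~~ edge a b /\ ~~ edge v d.
  by split; [apply: trG vb; rewrite edge_sym | apply: trG bd].
have neq_cv : c != v by apply: contraNneq nvd => <-.
have neq_bc : b != c by apply: contraNneq nab => ->.
have neq_da : d != a by apply: contraNneq nvd => ->.
have [le_bc|] := leqP #|neighbors b :&: neighbors c| R.
  apply: (@pentagon_domination G R a v b c trG) => //.
    by apply: leW neq_cv; rewrite // edge_sym.
  exact: leW.
move=> /(leq_ltn_trans R_gt0)/card_gt1P[x [y []]].
rewrite !inE => /andP[bx cx] /andP[by_ cy] neq_xy.
apply: (@pentagon_domination G R d c a b trG).
- by apply: leW neq_bc; rewrite edge_sym.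
- by apply: leW neq_da; rewrite // edge_sym.
apply: leq_trans (leW x c y cx cy neq_xy).
apply/subset_leq_card/subsetP => z; rewrite !inE => /andP[az bz].
apply/and3P; split.
- by apply: trG bz; rewrite edge_sym.
- by apply: trG az; rewrite edge_sym.
- by apply: trG bz; rewrite edge_sym.
Qed.

(** A vertex set that avoids the neighbourhood of an induced [P_3] contains no
    independent set of size [r], so Ramsey's theorem bounds its size. *)
Lemma path3_isolated_free_deletion (r : nat) : exists c, forall G : sgraph,
  triangle_free G ->
  ~~ embeds (disjoint_union (path_graph 3) (copies r (complete_graph 1))) G ->
  exists A B : {set G},
    [/\ independent A, independent B & #|~: (A :|: B)| <= c].
Proof.
have [N ramN] := ramsey 3 r; exists (3 * N.+1) => G trG nfree.
apply: few_non_neighbors_deletion => // a v b va vb neq_ab.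
apply: contraR nfree; rewrite -ltnNge => /ltnW/ltnW/ramN[] [K [sKW indK leK]].
  have /card_gt2P[x [y [z [[Kx Ky Kz] [xy yz zx]]]]] := leK.
  have exz : edge x z by apply: indK; rewrite // eq_sym.
  by move: (trG x y z (indK _ _ Kx Ky xy) (indK _ _ Ky Kz yz)); rewrite exz.
exact: path3_isolated_embeds sKW indK leK.
Qed.

Lemma clique_edgeless_free_deletion (F1 F2 : sgraph) :
  is_complete F1 -> edgeless F2 ->
  exists c, forall G : sgraph, ~~ embeds F1 G -> ~~ embeds F2 G ->
  exists A B : {set G},
    [/\ independent A, independent B & #|~: (A :|: B)| <= c].
Proof.
move=> complF1 edgelessF2; have [N ramN] := ramsey #|F1| #|F2|.
exists N => G nF1 nF2; exists set0, set0.
split; try by move=> x y; rewrite inE.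
rewrite setU0 setC0.
have [//|/ltnW/ramN[] [K [_ indK leK]]] := leqP #|[set: G]| N.
  by rewrite (embeds_clique complF1 indK leK) in nF1.
by rewrite (embeds_independent edgelessF2 indK leK) in nF2.
Qed.

Lemma complete2_free_bipartite (F G : sgraph) :
  embeds F (complete_graph 2) -> ~~ embeds F G -> bipartite G.
Proof.
move=> F2 nFG; exists set0; split=> x y; first by rewrite inE.
move=> _ _; apply: contra nFG => xy; apply: embeds_trans F2 _.
apply: (embeds_clique (K := [set x; y])) => [//|u v|].
  rewrite !inE => /orP[] /eqP-> /orP[] /eqP->; by rewrite ?eqxx // edge_sym.
rewrite card_ord cards2; case: eqVneq xy => // ->.
by rewrite edge_irrefl.
Qed.

Lemma path4_free_bipartite (G : sgraph) :
  triangle_free G -> ~~ embeds (path_graph 4) G -> bipartite G.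
Proof.
move=> trG nP4; apply: bipartite_path4_free => // a b c d ab bc cd ac bd.
by apply: contraR nP4; apply: path4_embeds ab bc cd ac bd.
Qed.

(** * Non-bipartite graphs and large families of them *)

Lemma bipartite_alternate (G : sgraph) (A : {set G}) (x y : G) :
  independent A -> independent (~: A) -> edge x y -> (y \in A) = ~~ (x \in A).
Proof.
move=> indA indB xy.
have [Ax|nAx] := boolP (x \in A); have [Ay|nAy] := boolP (y \in A) => //.
  by have := indA x y Ax Ay; rewrite xy.
by have := indB x y; rewrite !inE xy => /(_ nAx nAy).
Qed.

Lemma complete3_not_bipartite : ~ bipartite (complete_graph 3).
Proof.
case=> A [indA indB]; have alt := bipartite_alternate indA indB.
have := alt (@Ordinal 3 2 isT) (@Ordinal 3 0 isT) isT.
rewrite (alt (@Ordinal 3 1 isT) (@Ordinal 3 2 isT) isT).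
by rewrite (alt (@Ordinal 3 0 isT) (@Ordinal 3 1 isT) isT); case: (_ \in A).
Qed.

(** The cycle on [2 k + 3] vertices. *)
Definition odd_cycle_edge (k : nat) : rel 'I_k.*2.+3 := fun i j =>
  (i.+1 %% k.*2.+3 == j) || (j.+1 %% k.*2.+3 == i).

Lemma odd_cycle_sym (k : nat) : symmetric (@odd_cycle_edge k).
Proof. by move=> i j; rewrite /odd_cycle_edge orbC. Qed.

Lemma odd_cycle_irrefl (k : nat) : irreflexive (@odd_cycle_edge k).
Proof.
move=> i; rewrite /odd_cycle_edge orbb; apply/negbTE.
have [lt_i|] := ltnP i.+1 k.*2.+3; first by rewrite modn_small // gtn_eqF.
rewrite ltnS => le_i; have -> : i.+1 = k.*2.+3.
  by apply/eqP; rewrite eqn_leq ltn_ord ltnS.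
by rewrite modnn; case: (val i) le_i.
Qed.

Definition odd_cycle (k : nat) : sgraph :=
  SGraph (@odd_cycle_sym k) (@odd_cycle_irrefl k).

Lemma odd_cycle_not_bipartite (k : nat) : ~ bipartite (odd_cycle k).
Proof.
case=> A [indA indB]; have alt := bipartite_alternate indA indB.
have parity i : i < k.*2.+3 ->
    ((inord i : odd_cycle k) \in A) = ((ord0 : odd_cycle k) \in A) (+) odd i.
  elim: i => [_|i IHi lt_i].
    by rewrite addbF; congr (_ \in A); apply/val_inj; rewrite /= inordK.
  rewrite (alt (inord i)) ?IHi ?addbN //; first exact: ltnW.
  rewrite /= /odd_cycle_edge !inordK //; last exact: ltnW.
  by rewrite modn_small ?eqxx.
have := alt (inord k.*2.+2) ord0; rewrite parity //= odd_double addbF.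
rewrite /odd_cycle_edge /= inordK // modnn eqxx => /(_ isT).
by case: (_ \in A).
Qed.

(** Every vertex of [X] is replaced by [n] pairwise non-adjacent vertices. *)
Definition blowup_edge (n : nat) (X : sgraph) : rel ('I_n * X) :=
  fun u v => edge u.2 v.2.
Lemma blowup_sym (n : nat) (X : sgraph) : symmetric (@blowup_edge n X).
Proof. by move=> u v; apply: edge_sym. Qed.
Lemma blowup_irrefl (n : nat) (X : sgraph) : irreflexive (@blowup_edge n X).
Proof. by move=> u; apply: edge_irrefl. Qed.
Definition blowup (n : nat) (X : sgraph) : sgraph :=
  SGraph (@blowup_sym n X) (@blowup_irrefl n X).

Definition complete_on_edge (T : finType) : rel T := fun u v => u != v.
Lemma complete_on_sym (T : finType) : symmetric (@complete_on_edge T).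
Proof. by move=> u v; rewrite /complete_on_edge eq_sym. Qed.
Lemma complete_on_irrefl (T : finType) : irreflexive (@complete_on_edge T).
Proof. by move=> u; rewrite /complete_on_edge eqxx. Qed.
Definition complete_on (T : finType) : sgraph :=
  SGraph (@complete_on_sym T) (@complete_on_irrefl T).

(** A set of at most [c] vertices misses one of [c + 1] disjoint copies of
    [X], so what remains contains an odd cycle of [X]. *)
Lemma disjoint_copies_deletion (X G : sgraph) (c : nat)
    (f : 'I_c.+1 * X -> G) : injective f ->
  (forall i (x y : X), edge x y -> edge (f (i, x)) (f (i, y))) ->
  ~ bipartite X ->
  forall A B : {set G}, independent A -> independent B ->
  ~ #|~: (A :|: B)| <= c.
Proof.
move=> injf ef nbipX A B indA indB leABc; apply: nbipX.
set D := ~: (A :|: B) in leABc.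
have [/forallP hitD|] := boolP [forall i, [exists x, f (i, x) \in D]].
  pose h i := f (i, xchoose (existsP (hitD i))).
  have injh : injective h by move=> i j /injf[].
  suffices: c.+1 <= #|D| by rewrite ltnNge leABc.
  rewrite -[c.+1]card_ord -(card_codom injh).
  apply/subset_leq_card/subsetP => u.
  by case/codomP => i ->; apply: (xchooseP (existsP (hitD i))).
rewrite negb_forall => /existsP[i]; rewrite negb_exists => /forallP missi.
have inAB x : (f (i, x) \in A) || (f (i, x) \in B).
  by have := missi x; rewrite !inE negbK.
exists [set x | f (i, x) \in A]; split=> x y; rewrite !inE => Px Py.
  by apply: contra (indA _ _ Px Py) => /(ef i).
have inB z : f (i, z) \notin A -> f (i, z) \in B.
  by move=> nA; have := inAB z; rewrite (negbTE nA).
by apply: contra (indB _ _ (inB _ Px) (inB _ Py)) => /(ef i).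
Qed.

(** Hence one of the two forbidden graphs is an induced subgraph of some
    member of each family whose [n]-th member contains [n] disjoint copies of a
    non-bipartite graph. *)
Lemma bounded_apex_embeds (H1 H2 X : sgraph) (G : nat -> sgraph)
    (f : forall n, 'I_n * X -> G n) :
  bounded_apex_bipartite (free (pair_set H1 H2)) -> ~ bipartite X ->
  (forall n, injective (@f n)) ->
  (forall n i (x y : X), edge x y -> edge (f n (i, x)) (f n (i, y))) ->
  exists n, embeds H1 (G n) \/ embeds H2 (G n).
Proof.
move=> [c bound] nbipX injf ef; exists c.+1.
have [|nH1] := boolP (embeds H1 _); first by left.
have [|nH2] := boolP (embeds H2 _); first by right.
have frG : free (pair_set H1 H2) (G c.+1) by apply/freeP.
have /bipartite_deletionP[A [B [indA indB]]] := bound _ frG.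
by move/(disjoint_copies_deletion (injf c.+1) (@ef c.+1) nbipX indA indB).
Qed.

Lemma bounded_apex_copies (H1 H2 X : sgraph) :
  bounded_apex_bipartite (free (pair_set H1 H2)) -> ~ bipartite X ->
  exists n, embeds H1 (copies n X) \/ embeds H2 (copies n X).
Proof.
move=> bound nbipX.
apply: (@bounded_apex_embeds _ _ X (fun n => copies n X) (fun n u => u)) => //.
  by move=> n u v.
by move=> n i x y xy; rewrite /= /copies_edge /= eqxx.
Qed.

Lemma bounded_apex_blowup (H1 H2 X : sgraph) :
  bounded_apex_bipartite (free (pair_set H1 H2)) -> ~ bipartite X ->
  exists n, embeds H1 (blowup n X) \/ embeds H2 (blowup n X).
Proof.
move=> bound nbipX.
apply: (@bounded_apex_embeds _ _ X (fun n => blowup n X) (fun n u => u)) => //.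
by move=> n u v.
Qed.

Lemma bounded_apex_complete (H1 H2 : sgraph) :
  bounded_apex_bipartite (free (pair_set H1 H2)) ->
  is_complete H1 \/ is_complete H2.
Proof.
move=> bound.
pose G n := complete_on ('I_n * 'I_3)%type.
have complG H n : embeds H (G n) -> is_complete H.
  case/embedsP => f injf ef x y neq_xy.
  by rewrite -ef /= /complete_on_edge inj_eq.
have [|n u v //|n i x y|n [/complG|/complG]] :=
  @bounded_apex_embeds H1 H2 (complete_graph 3) G (fun n u => u) bound.
- exact: complete3_not_bipartite.
- by rewrite /= /complete_on_edge xpair_eqE eqxx.
- by left.
- by right.
Qed.

(** * Complete graphs and triangle-free families *)

Lemma complete_colouring (H X : sgraph) (T : finType) (c : X -> T) :
  (forall x y, edge x y -> c x != c y) -> is_complete H -> embeds H X ->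
  #|H| <= #|T|.
Proof.
move=> proper complH /embedsP[f injf ef]; apply: (leq_card (c \o f)) => x y.
apply: contra_eq => /complH; rewrite -ef; exact: proper.
Qed.

Lemma card_complete_copies3 (H : sgraph) (n : nat) : is_complete H ->
  embeds H (copies n (complete_graph 3)) -> #|H| <= 3.
Proof.
rewrite -[X in _ <= X](card_ord 3).
by apply: (@complete_colouring _ (copies n _) _ snd) => u v /andP[].
Qed.

Lemma card_complete_blowup3 (H : sgraph) (n : nat) : is_complete H ->
  embeds H (blowup n (complete_graph 3)) -> #|H| <= 3.
Proof.
rewrite -[X in _ <= X](card_ord 3).
exact: (@complete_colouring _ (blowup n (complete_graph 3)) _ snd).
Qed.

Lemma triangle_free_embeds (H G : sgraph) :
  triangle_free G -> embeds H G -> triangle_free H.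
Proof.
by move=> trG /embedsP[f _ ef] x y z; rewrite -!ef; apply: trG.
Qed.

Lemma triangle_free_copies (n : nat) (X : sgraph) :
  triangle_free X -> triangle_free (copies n X).
Proof.
move=> trX u v w /andP[_ uv] /andP[_ vw]; rewrite negb_and.
by rewrite (trX _ _ _ uv vw) orbT.
Qed.

Lemma triangle_free_blowup (n : nat) (X : sgraph) :
  triangle_free X -> triangle_free (blowup n X).
Proof. by move=> trX u v w; apply: trX. Qed.

Lemma card_complete_triangle_free (H : sgraph) :
  is_complete H -> triangle_free H -> #|H| <= 2.
Proof.
move=> complH trH; rewrite leqNgt; apply/negP.
case/card_gt2P => x [y [z [_ [xy yz zx]]]].
by have := trH x y z (complH _ _ xy) (complH _ _ yz); rewrite complH // eq_sym.
Qed.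

(** * Pentagons and heptagons *)

Lemma all_iota_ord (n : nat) (P : pred nat) :
  all P (iota 0 n) -> forall i : 'I_n, P i.
Proof. by move=> /allP PP i; apply: PP; rewrite mem_iota /=. Qed.

(** Adjacency on a cycle, on natural numbers instead of ordinals: the local
    facts about the pentagon and the heptagon can then be evaluated over all
    vertices, which the enumeration of an ordinal type does not allow. *)
Definition cycle_nat (n : nat) : rel nat := fun i j =>
  (i.+1 %% n == j) || (j.+1 %% n == i).

Notation forall_nat n P := (all P (iota 0 n)).

Lemma pentagon_edges (a b x y : odd_cycle 1) : edge a b -> edge x y ->
  [|| edge a x, edge a y, edge b x | edge b y].
Proof.
have: forall_nat 5 (fun a => forall_nat 5 (fun b => forall_nat 5 (fun x =>
    forall_nat 5 (fun y => cycle_nat 5 a b ==> cycle_nat 5 x y ==>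
    [|| cycle_nat 5 a x, cycle_nat 5 a y, cycle_nat 5 b x | cycle_nat 5 b y])))).
  by vm_compute.
move=> /all_iota_ord/(_ a)/all_iota_ord/(_ b)/all_iota_ord/(_ x).
move=> /all_iota_ord/(_ y) check ab xy.
exact: (implyP (implyP check ab) xy).
Qed.

Lemma pentagon_path4 (a b c d x : odd_cycle 1) :
  edge a b -> edge b c -> edge c d -> ~~ edge a d ->
  [|| edge a x, edge b x, edge c x | edge d x].
Proof.
have: forall_nat 5 (fun a => forall_nat 5 (fun b => forall_nat 5 (fun c =>
    forall_nat 5 (fun d => forall_nat 5 (fun x =>
    cycle_nat 5 a b ==> cycle_nat 5 b c ==> cycle_nat 5 c d ==>
    ~~ cycle_nat 5 a d ==>
    [|| cycle_nat 5 a x, cycle_nat 5 b x, cycle_nat 5 c x | cycle_nat 5 d x]))))).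
  by vm_compute.
move=> /all_iota_ord/(_ a)/all_iota_ord/(_ b)/all_iota_ord/(_ c).
move=> /all_iota_ord/(_ d)/all_iota_ord/(_ x) check ab bc cd ad.
exact: (implyP (implyP (implyP (implyP check ab) bc) cd) ad).
Qed.

Lemma pentagon_triangle_free : triangle_free (odd_cycle 1).
Proof.
move=> a b c.
have: forall_nat 5 (fun a => forall_nat 5 (fun b => forall_nat 5 (fun c =>
    cycle_nat 5 a b ==> cycle_nat 5 b c ==> ~~ cycle_nat 5 a c))).
  by vm_compute.
move=> /all_iota_ord/(_ a)/all_iota_ord/(_ b)/all_iota_ord/(_ c) check ab bc.
exact: (implyP (implyP check ab) bc).
Qed.

Lemma heptagon_triangle_free : triangle_free (odd_cycle 2).
Proof.
move=> a b c.
have: forall_nat 7 (fun a => forall_nat 7 (fun b => forall_nat 7 (fun c =>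
    cycle_nat 7 a b ==> cycle_nat 7 b c ==> ~~ cycle_nat 7 a c))).
  by vm_compute.
move=> /all_iota_ord/(_ a)/all_iota_ord/(_ b)/all_iota_ord/(_ c) check ab bc.
exact: (implyP (implyP check ab) bc).
Qed.

Lemma heptagon_degree (v a b c : odd_cycle 2) :
  edge v a -> edge v b -> edge v c -> [|| a == b, a == c | b == c].
Proof.
have: forall_nat 7 (fun v => forall_nat 7 (fun a => forall_nat 7 (fun b =>
    forall_nat 7 (fun c =>
    cycle_nat 7 v a ==> cycle_nat 7 v b ==> cycle_nat 7 v c ==>
    [|| a == b, a == c | b == c])))).
  by vm_compute.
move=> /all_iota_ord/(_ v)/all_iota_ord/(_ a)/all_iota_ord/(_ b).
move=> /all_iota_ord/(_ c) check va vb vc.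
exact: (implyP (implyP (implyP check va) vb) vc).
Qed.

Lemma heptagon_closed_walk4 (a b c d : odd_cycle 2) :
  edge a b -> edge b c -> edge c d -> edge d a -> (a == c) || (b == d).
Proof.
have: forall_nat 7 (fun a => forall_nat 7 (fun b => forall_nat 7 (fun c =>
    forall_nat 7 (fun d =>
    cycle_nat 7 a b ==> cycle_nat 7 b c ==> cycle_nat 7 c d ==>
    cycle_nat 7 d a ==> (a == c) || (b == d))))).
  by vm_compute.
move=> /all_iota_ord/(_ a)/all_iota_ord/(_ b)/all_iota_ord/(_ c).
move=> /all_iota_ord/(_ d) check ab bc cd da.
exact: (implyP (implyP (implyP (implyP check ab) bc) cd) da).
Qed.

Lemma heptagon_closed_walk5 (a b c d x : odd_cycle 2) :
  edge a b -> edge b c -> edge c d -> edge d x -> ~~ edge x a.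
Proof.
have: forall_nat 7 (fun a => forall_nat 7 (fun b => forall_nat 7 (fun c =>
    forall_nat 7 (fun d => forall_nat 7 (fun x =>
    cycle_nat 7 a b ==> cycle_nat 7 b c ==> cycle_nat 7 c d ==>
    cycle_nat 7 d x ==> ~~ cycle_nat 7 x a))))).
  by vm_compute.
move=> /all_iota_ord/(_ a)/all_iota_ord/(_ b)/all_iota_ord/(_ c).
move=> /all_iota_ord/(_ d)/all_iota_ord/(_ x) check ab bc cd dx.
exact: (implyP (implyP (implyP (implyP check ab) bc) cd) dx).
Qed.

(** * Linear forests in the families *)

(** A homomorphism that is injective on each neighbourhood: adjacent vertices
    go to the same copy, so forgetting the copy loses no local information. *)
Lemma embeds_copies_hom (H X : sgraph) (n : nat) : embeds H (copies n X) ->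
  exists g : H -> X, (forall x y, edge x y -> edge (g x) (g y)) /\
    (forall v x y, edge v x -> edge v y -> g x = g y -> x = y).
Proof.
case/embedsP => f injf ef; exists (fun x => (f x).2); split=> [x y|v x y].
  by rewrite -ef => /andP[].
rewrite -!ef => /andP[/eqP vx _] /andP[/eqP vy _] eq_g; apply: injf.
by rewrite [f x]surjective_pairing [f y]surjective_pairing eq_g -vx vy.
Qed.

Definition path_along (H : sgraph) (s : seq H) : Prop :=
  {in s &, forall x y, edge x y =
     ((index x s).+1 == index y s) || ((index y s).+1 == index x s)}.

Lemma path_alongI (H : sgraph) (x0 : H) (s : seq H) : uniq s ->
  (forall i j, i < j < size s ->
     edge (nth x0 s i) (nth x0 s j) = (i.+1 == j)) ->
  path_along s.
Proof.
move=> uniq_s edge_s x y sx sy.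
have [ix iy] : index x s < size s /\ index y s < size s by rewrite !index_mem.
have [lt_xy|lt_yx|eq_xy] := ltngtP (index x s) (index y s).
- rewrite -{1}(nth_index x0 sx) -{1}(nth_index x0 sy) edge_s ?lt_xy //.
  by rewrite [_.+1 == index x s]gtn_eqF ?orbF // ltnS ltnW.
- rewrite edge_sym -{1}(nth_index x0 sx) -{1}(nth_index x0 sy) edge_s ?lt_yx //.
  by rewrite [_.+1 == index y s]gtn_eqF // ltnS ltnW.
- rewrite -(nth_index x0 sx) eq_xy nth_index // edge_irrefl.
  by rewrite orbb gtn_eqF.
Qed.

Lemma path_isolated_embeds (H : sgraph) (s : seq H) :
  size s <= 3 -> path_along s -> (forall x y, edge x y -> x \in s) ->
  embeds H (disjoint_union (path_graph 3) (copies #|H| (complete_graph 1))).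
Proof.
move=> le_s3 path_s isolated.
have lt3 x : x \in s -> index x s < 3.
  by rewrite -index_mem => /leq_trans; apply.
pose f x : disjoint_union (path_graph 3) (copies #|H| (complete_graph 1)) :=
  if x \in s then inl (inord (index x s)) else inr (enum_rank x, ord0).
apply/embedsP; exists f => x y; rewrite /f.
  case: ifPn => sx; case: ifPn => sy //; last by case=> /enum_rank_inj.
  case=> /(congr1 (@nat_of_ord 3)); rewrite !inordK ?lt3 //; exact: index_inj.
case: ifPn => sx; case: ifPn => sy /=.
- by rewrite /path_edge !inordK ?lt3 // path_s.
- by apply/esym/negbTE; apply: contra sy; rewrite edge_sym => /isolated.
- by apply/esym/negbTE; apply: contra sx => /isolated.
- rewrite /copies_edge /= /complete_edge eqxx andbF.
  by apply/esym/negbTE; apply: contra sx => /isolated.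
Qed.

Lemma path_spanning_embeds (H : sgraph) (s : seq H) (n : nat) :
  size s <= n.+1 -> path_along s -> (forall x, x \in s) ->
  embeds H (path_graph n.+1).
Proof.
move=> le_sn path_s all_s.
have lt_n x : index x s < n.+1 by apply: leq_trans le_sn; rewrite index_mem.
apply/embedsP; exists (fun x => inord (index x s)) => x y.
  move/(congr1 (@nat_of_ord n.+1)); rewrite !inordK ?lt_n //; exact: index_inj.
by rewrite /= /path_edge !inordK ?lt_n // path_s.
Qed.

(** The heptagon gives [H] maximum degree two and no short cycle, hence only
    path components or long cycles; the pentagon forbids two disjoint
    non-adjacent edges and any vertex that is not adjacent to an induced path
    on four vertices. Thus at most one component is non-trivial, it has at
    most four vertices, and if it has four then there is nothing else. *)
Lemma heptagon_pentagon_paths (H : sgraph) (m n : nat) :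
  embeds H (copies m (odd_cycle 2)) -> embeds H (blowup n (odd_cycle 1)) ->
  embeds H (path_graph 4) \/
  exists r,
    embeds H (disjoint_union (path_graph 3) (copies r (complete_graph 1))).
Proof.
move=> H7 /embedsP[f _ ef].
have trH : triangle_free H.
  exact: triangle_free_embeds (triangle_free_copies heptagon_triangle_free) H7.
have [g [hom_g inj_g]] := embeds_copies_hom H7.
have degree2 (v a b c : H) : edge v a -> edge v b -> edge v c ->
    [|| a == b, a == c | b == c].
  move=> va vb vc.
  case/or3P: (heptagon_degree (hom_g _ _ va) (hom_g _ _ vb) (hom_g _ _ vc));
    move/eqP.
  - by move=> /(inj_g v _ _ va vb)->; rewrite eqxx.
  - by move=> /(inj_g v _ _ va vc)->; rewrite eqxx orbT.
  - by move=> /(inj_g v _ _ vb vc)->; rewrite eqxx !orbT.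
have no_cycle4 (a b c d : H) : edge a b -> edge b c -> edge c d -> edge d a ->
    (a == c) || (b == d).
  move=> ab bc cd da.
  case/orP: (heptagon_closed_walk4 (hom_g _ _ ab) (hom_g _ _ bc) (hom_g _ _ cd)
              (hom_g _ _ da)) => /eqP.
  - by move/(inj_g b)->; rewrite ?eqxx // edge_sym.
  - by move/(inj_g a)->; rewrite ?eqxx ?orbT // edge_sym.
have no_cycle5 (a b c d x : H) : edge a b -> edge b c -> edge c d ->
    edge d x -> ~~ edge x a.
  move=> ab bc cd dx; apply/negP => /hom_g; apply/negP.
  exact: heptagon_closed_walk5 (hom_g _ _ ab) (hom_g _ _ bc) (hom_g _ _ cd)
           (hom_g _ _ dx).
have edges (a b x y : H) : edge a b -> edge x y ->
    [|| edge a x, edge a y, edge b x | edge b y].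
  by rewrite -!ef; apply: pentagon_edges.
have path4 (a b c d x : H) : edge a b -> edge b c -> edge c d -> ~~ edge a d ->
    [|| edge a x, edge b x, edge c x | edge d x].
  by rewrite -!ef; apply: pentagon_path4.
have neq u v : edge u v -> (u == v :> H) = false.
  by apply: contraTF => /eqP->; rewrite edge_irrefl.
pose P4 (p : H * H * (H * H)) :=
  [&& edge p.1.1 p.1.2, edge p.1.2 p.2.1, edge p.2.1 p.2.2,
      p.1.1 != p.2.1 & p.1.2 != p.2.2].
case: (pickP P4) => [[[a b] [c d]] /and5P[/= ab bc cd neq_ac neq_bd]|noP4].
  have nad : ~~ edge a d.
    apply: contra neq_bd; rewrite edge_sym => da.
    by have := no_cycle4 _ _ _ _ ab bc cd da; rewrite (negbTE neq_ac).
  have neq_ad : a != d.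
    by apply: contraTneq ab => ->; rewrite edge_sym (trH b c).
  left; apply: (@path_spanning_embeds _ [:: a; b; c; d]) => // [|x].
    apply: (path_alongI (x0 := a)).
      by rewrite /= !inE !negb_or neq_ac neq_bd neq_ad !neq.
    case=> [|[|[|[|i]]]] [|[|[|[|j]]]] // /andP[] //= _ _; apply: negbTE => //.
      exact: trH ab bc.
    exact: trH bc cd.
  rewrite -[_ \in _]negbK !inE !negb_or; apply/negP => /and4P[xa xb xc xd].
  have nbx : ~~ edge b x.
    apply/negP => bx; have := degree2 b a c x; rewrite edge_sym ab bc bx.
    rewrite (negbTE neq_ac) ![_ == x]eq_sym (negbTE xa) (negbTE xc).
    by move=> /(_ _ _ _)/negP[].
  have ncx : ~~ edge c x.
    apply/negP => cx; have := degree2 c b d x; rewrite edge_sym bc cd cx.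
    rewrite (negbTE neq_bd) ![_ == x]eq_sym (negbTE xb) (negbTE xd).
    by move=> /(_ _ _ _)/negP[].
  case/or4P: (path4 a b c d x ab bc cd nad) => [ax|bx|cx|dx].
  - have xa' : edge x a by rewrite edge_sym.
    have := edges _ _ _ _ xa' cd; rewrite ![edge x _]edge_sym (negbTE ncx).
    rewrite (negbTE nad) (negbTE (trH _ _ _ ab bc)) !orbF /=.
    by apply/negP; apply: no_cycle5 xa' ab bc cd.
  - by rewrite bx in nbx.
  - by rewrite cx in ncx.
  - have := edges _ _ _ _ ab dx; rewrite (negbTE nad) (negbTE nbx) orbF.
    rewrite (negbTE (trH _ _ _ bc cd)) orbF /= edge_sym; apply/negP.
    exact: no_cycle5 ab bc cd dx.
have {}noP4 (a b c d : H) : edge a b -> edge b c -> edge c d -> a != c -> b = d.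
  move=> ab bc cd ac; apply/eqP; have := noP4 (a, b, (c, d)).
  by rewrite /P4 /= ab bc cd ac => /negbFE.
right; exists #|H|.
have isolated (s : seq H) (a b : H) : a \in s -> b \in s -> edge a b ->
    (forall z w, z \notin s -> w \in s -> ~~ edge w z) ->
    forall x y, edge x y -> x \in s.
  move=> sa sb ab sep x y xy; apply: contraT => nsx.
  have [sy|nsy] := boolP (y \in s).
    by have := sep x y nsx sy; rewrite edge_sym xy.
  have := edges a b x y ab xy.
  by rewrite !(negbTE (sep _ _ _ _)).
pose P3 (p : H * H * H) := [&& edge p.1.1 p.1.2, edge p.1.2 p.2 & p.1.1 != p.2].
case: (pickP P3) => [[[a b] c] /and3P[/= ab bc neq_ac]|noP3].
  apply: (@path_isolated_embeds _ [:: a; b; c]) => //.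
    apply: (path_alongI (x0 := a)).
      by rewrite /= !inE negb_or neq_ac !neq.
    case=> [|[|[|i]]] [|[|[|j]]] // /andP[] //= _ _.
    exact: negbTE (trH _ _ _ ab bc).
  apply: (isolated _ a b); rewrite ?inE ?eqxx ?orbT // => z w.
  rewrite !inE !negb_or => /and3P[za zb zc] /or3P[] /eqP->; apply/negP => wz.
  - case/eqP: neq_ac; apply: (noP4 z a b c) => //; by rewrite edge_sym.
  - have := degree2 b a c z; rewrite edge_sym ab bc wz (negbTE neq_ac).
    by rewrite ![_ == z]eq_sym (negbTE za) (negbTE zc) => /(_ _ _ _)/negP[].
  - case/eqP: neq_ac; apply/esym/(noP4 z c b a) => //; by rewrite edge_sym.
have {}noP3 (a b c : H) : edge a b -> edge b c -> a = c.
  move=> ab bc; apply/eqP; have := noP3 (a, b, c).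
  by rewrite /P3 /= ab bc => /negbFE.
case: (pickP (fun p : H * H => edge p.1 p.2)) => [[a b] /= ab|edgelessH].
  apply: (@path_isolated_embeds _ [:: a; b]) => //.
    apply: (path_alongI (x0 := a)); first by rewrite /= !inE !neq.
    by case=> [|[|i]] [|[|j]] // /andP[].
  apply: (isolated _ a b); rewrite ?inE ?eqxx ?orbT // => z w.
  rewrite !inE !negb_or => /andP[za zb] /orP[] /eqP->; apply/negP => wz.
  - by case/eqP: zb; apply: (noP3 z a b); rewrite // edge_sym.
  - by case/eqP: za; apply: (noP3 z b a); rewrite // edge_sym.
apply: (@path_isolated_embeds _ [::]) => // x y.
by rewrite (edgelessH (x, y)).
Qed.

Lemma complete_embeds_complete_graph (H : sgraph) (n : nat) :
  is_complete H -> #|H| <= n -> embeds H (complete_graph n).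
Proof.
move=> complH leHn; apply: (embeds_clique (K := setT) complH) => [//|].
by rewrite cardsT card_ord.
Qed.

(** Being an induced subgraph of disjoint triangles makes adjacency transitive,
    being one of a complete tripartite graph makes non-adjacency transitive. *)
Lemma cluster_multipartite_edgeless (H : sgraph) (m n : nat) :
  triangle_free H ->
  embeds H (copies m (complete_graph 3)) ->
  embeds H (blowup n (complete_graph 3)) ->
  edgeless H \/ embeds H (complete_graph 2).
Proof.
move=> trH /embedsP[f injf ef] /embedsP[g _ eg].
have noP3 (x y z : H) : edge x y -> edge y z -> x = z.
  move=> xy yz; have := trH x y z xy yz; move: xy yz; rewrite -!ef.
  rewrite /= /copies_edge /= /complete_edge.
  move=> /andP[/eqP eq_xy _] /andP[/eqP eq_yz _].
  rewrite eq_xy eq_yz eqxx negbK => /eqP eq2; apply: injf.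
  by rewrite [f x]surjective_pairing [f z]surjective_pairing eq2 eq_xy eq_yz.
have non_edge_trans (x y z : H) : ~~ edge x y -> ~~ edge y z -> ~~ edge x z.
  rewrite -!eg /= /blowup_edge /= /complete_edge !negbK.
  by move=> /eqP-> /eqP->.
case: (pickP (fun p : H * H => edge p.1 p.2)) => [[a b] /= ab|edgelessH].
  2: by left=> x y; rewrite (edgelessH (x, y)).
have all_ab x : x \in [set a; b].
  rewrite !inE; apply: contraT; rewrite negb_or => /andP[xa xb].
  have := non_edge_trans a x b; rewrite ab; apply.
    by apply: contra xb; rewrite edge_sym => xa'; rewrite (noP3 x a b).
  by apply: contra xa => xb'; rewrite (noP3 x b a) // edge_sym.
right; apply: complete_embeds_complete_graph.
  move=> x y; have := all_ab x; have := all_ab y; rewrite !inE.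
  by move=> /orP[] /eqP-> /orP[] /eqP->; rewrite ?eqxx // edge_sym.
rewrite -cardsT (leq_trans (subset_leq_card (_ : _ \subset [set a; b]))) //.
  by apply/subsetP => x _.
by rewrite cards2; case: (_ != _).
Qed.

(** * The characterisation *)

Definition listed_pair (F1 F2 : sgraph) : Prop :=
  induced_subgraph F1 (complete_graph 2)
  \/ (graph_iso F1 (complete_graph 3) /\
      ((exists r : nat,
          induced_subgraph F2
            (disjoint_union (path_graph 3) (copies r (complete_graph 1))))
       \/ induced_subgraph F2 (path_graph 4)))
  \/ (is_complete F1 /\ edgeless F2).

Lemma bounded_apex_pair_sym (H1 H2 : sgraph) :
  bounded_apex_bipartite (free (pair_set H1 H2)) ->
  bounded_apex_bipartite (free (pair_set H2 H1)).
Proof.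
case=> c bound; exists c => G /freeP[nH2 nH1]; apply: bound.
exact/freeP.
Qed.

Lemma listed_pair_bounded (F1 F2 : sgraph) : listed_pair F1 F2 ->
  bounded_apex_bipartite (free (pair_set F1 F2)).
Proof.
case=> [/induced_subgraphP F1K2|[[isoF1 [[r]|]]|[complF1 edgelessF2]]].
- exists 0 => G /freeP[nF1 _]; apply/bipartite_deletionP/bipartiteP.
  exact: complete2_free_bipartite nF1.
- move/induced_subgraphP => F2P3.
  have [c bound] := path3_isolated_free_deletion r.
  exists c => G /freeP[nF1 nF2]; apply/bipartite_deletionP/bound.
    exact: iso_complete3_free nF1.
  by apply: contra nF2; apply: embeds_trans.
- move/induced_subgraphP => F2P4; exists 0 => G /freeP[nF1 nF2].
  apply/bipartite_deletionP/bipartiteP/path4_free_bipartite.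
    exact: iso_complete3_free nF1.
  by apply: contra nF2; apply: embeds_trans.
- have [c bound] := clique_edgeless_free_deletion complF1 edgelessF2.
  by exists c => G /freeP[nF1 nF2]; apply/bipartite_deletionP/bound.
Qed.

(** When the members of one of the families above are [H1]-free, some member
    has an induced [H2]. If [H1] is a triangle, this applies to the disjoint
    unions of heptagons and to the blow-ups of a pentagon; if [H1] is larger,
    to the disjoint unions of triangles and to the complete tripartite graphs
    as well. *)
Lemma bounded_complete_listed_pair (H1 H2 : sgraph) :
  bounded_apex_bipartite (free (pair_set H1 H2)) -> is_complete H1 ->
  listed_pair H1 H2 \/ listed_pair H2 H1.
Proof.
move=> bound complH1.
have [le2|gt2] := leqP #|H1| 2.
  left; left; apply/induced_subgraphP.
  exact: complete_embeds_complete_graph.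
have ntrH1 (G : sgraph) : triangle_free G -> ~ embeds H1 G.
  move=> trG /(triangle_free_embeds trG)/(card_complete_triangle_free complH1).
  by rewrite leqNgt gt2.
have [m [|H2C7]] := bounded_apex_copies bound (@odd_cycle_not_bipartite 2).
  by move/ntrH1; case; apply/triangle_free_copies/heptagon_triangle_free.
have trH2 : triangle_free H2.
  exact: triangle_free_embeds (triangle_free_copies heptagon_triangle_free) H2C7.
have [le3|gt3] := leqP #|H1| 3.
  have [n [|H2C5]] := bounded_apex_blowup bound (@odd_cycle_not_bipartite 1).
    by move/ntrH1; case; apply/triangle_free_blowup/pentagon_triangle_free.
  left; right; left; split.
    have /embedsP[f injf ef] := complete_embeds_complete_graph complH1 le3.
    by exists f => //; apply: inj_card_bij injf _; rewrite card_ord.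
  have [P4|[r P3]] := heptagon_pentagon_paths H2C7 H2C5.
    by right; apply/induced_subgraphP.
  by left; exists r; apply/induced_subgraphP.
have [p [/(card_complete_copies3 complH1)|H2K3]] :=
  bounded_apex_copies bound complete3_not_bipartite; first by rewrite leqNgt gt3.
have [q [/(card_complete_blowup3 complH1)|H2K333]] :=
  bounded_apex_blowup bound complete3_not_bipartite; first by rewrite leqNgt gt3.
have [edgelessH2|H2K2] := cluster_multipartite_edgeless trH2 H2K3 H2K333.
  by left; right; right.
by right; left; apply/induced_subgraphP.
Qed.

Theorem theorem9p2 (H1 H2 : sgraph) :
  bounded_apex_bipartite (free (pair_set H1 H2)) <->
  exists F1 F2 : sgraph,
    ((F1 = H1 /\ F2 = H2) \/ (F1 = H2 /\ F2 = H1)) /\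
    ( induced_subgraph F1 (complete_graph 2)
    \/ (graph_iso F1 (complete_graph 3) /\
        ((exists r : nat,
            induced_subgraph F2
              (disjoint_union (path_graph 3) (copies r (complete_graph 1))))
         \/ induced_subgraph F2 (path_graph 4)))
    \/ (is_complete F1 /\ edgeless F2)).
Proof.
split=> [bound|[F1 [F2 [[[-> ->]|[-> ->]] /listed_pair_bounded bound]]]] //;
  last exact: bounded_apex_pair_sym.
suffices [pair|pair] : listed_pair H1 H2 \/ listed_pair H2 H1.
- by exists H1, H2; split; [left|].
- by exists H2, H1; split; [right|].
case: (bounded_apex_complete bound) => [|complH2].
  exact: bounded_complete_listed_pair.
apply/or_comm; apply: bounded_complete_listed_pair complH2.
exact: bounded_apex_pair_sym.
Qed.
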